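(* Let $T$ be an interval exchange transformation of $[0,1)$. Then $C_\psi(T)\le\min(1,\tau(T))$. In particular, if $\tau(T)=0$ then $C_\psi(T)=0$.
   Context: An $r$-interval exchange transformation is given by a permutation $\pi$ of $\{1,\dots,r\}$ and lengths $\ell_i>0$ with $\sum\ell_i=1$: with $s_0=0$, $s_k=\sum_{i\le k}\ell_i$, $I_k=[s_{k-1},s_k)$, $T(x)=x-\sum_{i<k}\ell_i+\sum_{\pi(i')<\pi(k)}\ell_{i'}$ for $x\in I_k$. Let $\oplus,\ominus$ denote addition and subtraction modulo $1$ on $[0,1)$. Set $\Delta(T)=\{T(x)\ominus x: x\in[0,1)\}$ (a finite set), $\Delta'(T)=\{u\ominus v: u,v\in\Delta(T)\}$, $\Delta'_n(T)=\bigcup_{k=1}^n\Delta'(T^k)$, and the $\tau$-entropy $\tau(T)=\limsup_{n\to\infty}\frac{\log\operatorname{card}\Delta'_n(T)}{\log n}$. With $\lambda$ Lebesgue measure and $\|t\|$ the distance from $t$ to the nearest integer, $C_\psi(T)=\sup\big(\{0\}\cup\{\alpha>0:\liminf_n n^\alpha\|T^nx-T^ny\|=0\text{ for }\lambda\times\lambda\text{-a.e. }(x,y)\}\big)$. *)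

(* Defs.v *)
From HB Require Import structures.
From mathcomp Require Import all_boot all_order all_algebra all_fingroup.
From mathcomp Require Import finmap.
From mathcomp Require Import all_classical all_reals all_analysis.
Set Implicit Arguments. Unset Strict Implicit. Unset Printing Implicit Defensive.
Import Order.TTheory GRing.Theory Num.Theory.
Import numFieldNormedType.Exports.
Local Open Scope classical_set_scope.
Local Open Scope ring_scope.

Section IET.
Variable R : realType.

Definition fracR (t : R) : R := t - (Num.floor t)%:~R.
Definition subm1 (u v : R) : R := fracR (u - v).
Definition distZ (t : R) : R := Num.min (fracR t) (1 - fracR t).

(* s_k = sum_{i <= k} l_i (1-based); for k : 'I_r (0-based) the interval
   I_k = [left_end k, right_end k) *)
Definition left_end (r : nat) (l : 'I_r -> R) (k : 'I_r) : R :=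
  \sum_(i < r | (i < k)%N) l i.
Definition right_end (r : nat) (l : 'I_r -> R) (k : 'I_r) : R :=
  \sum_(i < r | (i <= k)%N) l i.

(* The r-interval exchange transformation with permutation pi and lengths l:
   T x = x - sum_{i<k} l_i + sum_{pi i' < pi k} l_i' for x in I_k.
   (Outside [0,1), where no I_k contains x, T is the identity; irrelevant.) *)
Definition iet (r : nat) (pi : {perm 'I_r}) (l : 'I_r -> R) (x : R) : R :=
  x + \sum_(k < r)
        (if (left_end l k <= x) && (x < right_end l k)
         then (\sum_(i < r | (pi i < pi k)%N) l i) - left_end l k
         else 0).

Definition iet_data (r : nat) (l : 'I_r -> R) : Prop :=
  (forall i, 0 < l i) /\ \sum_(i < r) l i = 1.

Definition Delta (S : R -> R) : set R :=
  [set subm1 (S x) x | x in `[0, 1[%classic].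
Definition Delta' (S : R -> R) : set R :=
  [set subm1 u v | u in Delta S & v in Delta S].
Definition Delta'_n (T : R -> R) (n : nat) : set R :=
  \bigcup_(k in [set k : nat | (1 <= k <= n)%N]) Delta' (iter k T).

Definition cardR (A : set R) : nat := #|` fset_set A|.

Definition tau_entropy (T : R -> R) : \bar R :=
  limn_esup (fun n : nat => ((ln (cardR (Delta'_n T n))%:R / ln n%:R))%:E).

Definition Cpsi_set (T : R -> R) : set R :=
  [set a | 0 < a /\
     {ae (@lebesgue_measure R \x @lebesgue_measure R)%E,
        forall z : R * R, z.1 \in `[0, 1[ -> z.2 \in `[0, 1[ ->
          limn_einf (fun n : nat =>
            ((n%:R `^ a) * distZ (iter n T z.1 - iter n T z.2))%:E) = 0%E}].

Definition Cpsi (T : R -> R) : \bar R :=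
  ereal_sup ([set 0%E] `|` [set a%:E | a in Cpsi_set T]).

End IET.

(* Main.v *)
(* Write B for the set of (x, y) such that ||T^n x - T^n y|| < 2^(- j a) for some n in
   [2^j, 2^(j+1)). Its vertical sections are covered in two ways by sets of measure
   O(2^(- j a)): by one set for each n, because T preserves Lebesgue measure, and by one
   set for each u in Delta'_(2^(j+1)), because T^n x - T^n y = x - y + u modulo 1 for
   such a u. Hence if a > 1 (first cover), or if a > tau(T) (second cover), the measure
   of B decays geometrically in j, and by Borel-Cantelli almost every (x, y) lies in
   finitely many of these sets, so that liminf n^a ||T^n x - T^n y|| >= 1. *)
Require Import Defs.
From HB Require Import structures.
From mathcomp Require Import all_boot all_order all_algebra all_fingroup.
From mathcomp Require Import finmap.
From mathcomp Require Import all_classical all_reals all_analysis.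
From mathcomp Require Import measurable_realfun ring lra zify.
Import Order.TTheory GRing.Theory Num.Theory.
Import numFieldNormedType.Exports.
Local Open Scope classical_set_scope.
Local Open Scope ring_scope.

(** The pushforward of Lebesgue measure under a translation has the right value on half-open
    intervals, and this determines it. *)
Lemma lebesgue_measure_shift (R : realType) (c : R) (A : set (measurableTypeR R)) :
  measurable A ->
  lebesgue_measure ((fun x : R => x + c) @^-1` A) = lebesgue_measure A.
Proof.
move=> mA; apply/esym.
have mf : measurable_fun setT (fun x : measurableTypeR R => x + c).
  exact: measurable_funD.
pose f := @mfun_Sub _ _ (measurableTypeR R) (measurableTypeR R) _ (mem_set mf).
rewrite -[RHS]/(pushforward lebesgue_measure f A).
apply: lebesgue_measure_unique => // X [[a b] _ <-].
have fX : [set` `](a - c), (b - c)]] = f @^-1` [set` `]a, b]].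
  by apply/seteqP; split=> x /=; rewrite !in_itv/= ltrBlDr lerBrDr.
rewrite -[RHS]/(lebesgue_measure (f @^-1` [set` `]a, b]])) -fX.
rewrite !lebesgue_measure_itv/= !lte_fin ltrD2r.
by case: ifP => // _; rewrite -!EFinB; congr (_%:E); lra.
Qed.

(** * Distance to the nearest integer *)

Section DistZ.
Context {R : realType}.
Implicit Types (t d c : R) (m : int).

Lemma fracR_itv t : 0 <= fracR t < 1.
Proof.
by rewrite /fracR subr_ge0 floor_le ltrBlDr addrC -intrD1 floorD1_gt.
Qed.

Lemma distZDz t m : distZ (t + m%:~R) = distZ t.
Proof.
have fr : fracR (t + m%:~R) = fracR t.
  rewrite /fracR floorDrz ?intrKfloor ?intr_int//.
  by rewrite rmorphD/=; lra.
by rewrite /distZ fr.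
Qed.

Lemma distZ_le_norm t m : distZ t <= `|t - m%:~R|.
Proof.
have fl := fracR_itv t; rewrite /distZ ge_min.
have [mt|tm] := leP m (Num.floor t).
  apply/orP; left; rewrite /fracR ger0_norm.
    by rewrite lerD2l lerN2 ler_int.
  by rewrite subr_ge0 (le_trans _ (floor_le t))// ler_int.
apply/orP; right.
have : ((Num.floor t + 1)%:~R <= m%:~R :> R) by rewrite ler_int lezD1.
rewrite /fracR in fl *; rewrite intrD => h; rewrite ler0_norm; lra.
Qed.

(** The two candidates come from the two arguments of the minimum. Locating [m] makes it possible to
    count the relevant integers in [lebesgue_measure_window]. *)
Lemma distZ_ltP t d : distZ t < d ->
  exists2 m, (m = Num.floor t \/ m = Num.floor t + 1) & (`|t - m%:~R| < d).
Proof.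
have fl := fracR_itv t; rewrite /distZ /fracR in fl *; rewrite gt_min => /orP[h|h].
  by exists (Num.floor t); [left|rewrite ger0_norm; lra].
by exists (Num.floor t + 1); [right|rewrite intrD ler0_norm; lra].
Qed.

Lemma measurable_distZ_lt d :
  measurable ([set t | distZ t < d] : set (measurableTypeR R)).
Proof.
suff -> : [set t | distZ t < d] = \bigcup_(m : int) ball (m%:~R : R) d.
  by apply: open_measurable; apply: bigcup_open => m _; exact: ball_open.
apply/seteqP; split=> [t /= /distZ_ltP[m _ h]|t [m _ /= h]].
  by exists m => //; rewrite -ball_normE /= distrC.
rewrite -ball_normE /= distrC in h.
exact: le_lt_trans (distZ_le_norm t m) h.
Qed.

Lemma measurable_window (f : R -> R) d : measurable_fun setT f ->
  measurable ([set y | (y \in `[0, 1[) /\ (distZ (f y) < d)] :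
    set (measurableTypeR R)).
Proof.
move=> mf; apply: measurableI => //; first exact: measurable_itv.
by rewrite -[X in measurable X]setTI; exact: (mf measurableT _ (measurable_distZ_lt d)).
Qed.

(* If [0 <= y < 1], an integer within [d] of [c - y] is one of the floor of [c]
   and its two neighbours. *)
Lemma lebesgue_measure_window c d : 0 <= d ->
  (lebesgue_measure [set y : R | (y \in `[0%R, 1%R[) /\ (distZ (c - y) < d)%R]
  <= (6 * d)%:E)%E.
Proof.
move=> d0.
pose B (k : nat) : set R :=
  ball (c - (Num.floor c - 1 + k%:Z)%:~R) d.
apply: (@le_trans _ _ (\sum_(k < 3) lebesgue_measure (B k))%E).
  apply: content_subadditive => [k _||y /= [+ /distZ_ltP[m]]].
  - exact: (measurable_ball (R := R)).
  - by apply: measurable_window; apply: measurable_funB.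
  rewrite in_itv/= => /andP[y0 y1] hm hd.
  rewrite -bigcup_mkord.
  have hB k : m = (Num.floor c - 1 + k%:Z) -> B k y.
    move=> mk; rewrite /B -ball_normE/= -mk.
    by rewrite (_ : _ - _ = c - y - m%:~R)//; lra.
  (* The floor of [c - y] is that of [c] or one less, and [m] is that floor or one more: three
     values in all. *)
  have f1 : (Num.floor (c - y) <= Num.floor c) by apply: le_floor; lra.
  have f2 : (Num.floor c - 1 <= Num.floor (c - y)).
    rewrite -(@intrKfloor R (Num.floor c - 1)) le_floor//.
    by rewrite intrD/=; have := floor_le c; lra.
  have : m = (Num.floor c - 1 + 0%:Z) \/ m = (Num.floor c - 1 + 1%:Z) \/
    m = (Num.floor c - 1 + 2%:Z) by lia.
  by case=> [/hB|[/hB|/hB]] ?; [exists 0%N|exists 1%N|exists 2%N].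
(* Three balls of measure [2 * d] each give the constant 6. *)
rewrite !big_ord_recr big_ord0 /= !lebesgue_measure_ball//.
by rewrite add0e -!EFinD lee_fin; lra.
Qed.

End DistZ.

(** * Measure bounds and limits of sequences *)

Lemma measure_finite_cover {d} {T : measurableType d} {R : realType}
    {mu : {measure set T -> \bar R}} {I : choiceType} (D : set I)
    (B : I -> set T) {A : set T} {c : R} :
  finite_set D -> measurable A ->
  (forall i, D i -> measurable (B i) /\ (mu (B i) <= c%:E)%E) ->
  A `<=` \bigcup_(i in D) B i -> (mu A <= (c *+ #|` fset_set D|)%:E)%E.
Proof.
move=> fD mA mB AB.
apply: le_trans (content_sub_fsum _ fD _ mA AB) _ => [i /mB[]//|].
rewrite fsbig_finite//= big_seq.
apply: (@le_trans _ _ (\sum_(i <- fset_set D | i \in fset_set D) c%:E)%E).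
  by apply: lee_sum => i; rewrite in_fset_set// inE => /mB[].
by rewrite -big_seq sumEFin big_const_seq count_predT iter_addr_0.
Qed.

(** By Fubini the left side is the integral of the section measures, which are at most [c] on [A]
    and zero off [A]. *)
Lemma product_measure1_le d1 d2 (T1 : measurableType d1) (T2 : measurableType d2)
    (R : realType) (m1 : {measure set T1 -> \bar R})
    (m2 : {sigma_finite_measure set T2 -> \bar R})
    (A : set T1) (E : set (T1 * T2)) (c : \bar R) :
  measurable A -> measurable E -> (0 <= c)%E -> (forall z, E z -> A z.1) ->
  (forall x, A x -> (m2 (xsection E x) <= c)%E) ->
  ((m1 \x m2) E <= c * m1 A)%E.
Proof.
move=> mA mE c0 EA Ec; rewrite -integral_cst// integral_mkcond.
apply: ge0_le_integral => //.
- exact: measurable_fun_xsection.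
- by apply/(measurable_restrictT _ mA); exact: measurable_cst.
move=> x _ /=; rewrite patchE; case: ifPn; first by rewrite inE; exact: Ec.
rewrite notin_setE => Ax; rewrite (_ : xsection E x = set0) ?measure0//.
by apply/seteqP; split=> // y /=; rewrite /xsection/= inE => /EA.
Qed.

Lemma limn_einf_ge (R : realType) (u : (\bar R)^nat) (c : \bar R) :
  (\forall n \near \oo, (c <= u n)%E) -> (c <= limn_einf u)%E.
Proof.
move=> cu; rewrite /limn_einf leeNr /limn_esup limf_esupE.
apply: (@le_trans _ _ (ereal_sup ((\- u)%E @` [set n | (c <= u n)%E]))).
  by apply: ereal_inf_lbound; exists [set n | (c <= u n)%E].
by apply: ge_ereal_sup => _ [n /= cn <-]; rewrite leeN2.
Qed.

Lemma limn_esup_lt {R : realType} {u : (\bar R)^nat} {c : \bar R} :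
  (limn_esup u < c)%E -> \forall n \near \oo, (u n < c)%E.
Proof.
rewrite /limn_esup limf_esupE => /ereal_inf_lt[_ [V nV <-] supc].
apply: filterS nV => n Vn; apply: le_lt_trans supc.
by apply: ereal_sup_ubound; exists n.
Qed.

Lemma nneseries_geometric_lty {R : realType} (u : (\bar R)^nat) (c q : R) :
  0 <= c -> 0 < q < 1 -> (forall n, 0 <= u n <= (c * q ^+ n)%:E)%E ->
  (\sum_(n <oo) u n < +oo)%E.
Proof.
move=> c0 /andP[q0 q1] uq.
apply: (@le_lt_trans _ _ (c / (1 - q))%:E); last exact: ltry.
apply: lime_le; first by apply: is_cvg_nneseries => n _ _; case/andP: (uq n).
apply: nearW => n; apply: (@le_trans _ _ (\sum_(0 <= k < n) (c * q ^+ k)%:E)%E).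
  by apply: lee_sum => k _; case/andP: (uq k).
rewrite sumEFin lee_fin; apply: geometric_le_lim => //.
by rewrite ger0_norm// ltW.
Qed.

(** * Partial sums of the lengths in an arbitrary order of the indices *)

Section PartialSums.
Context {R : realType} {r : nat} {l : 'I_r -> R} (hl : iet_data l).
Context {f : 'I_r -> nat} (fI : injective f).

(** For [f] the inclusion of ['I_r] in the naturals this is the left end of [I_k]; for [f] given by
    [pi] it is the left end of the image of [I_k] under [T]. *)
Let start k := \sum_(i < r | (f i < f k)%N) l i.

Lemma psum_ge0 k : 0 <= start k.
Proof. by apply: sumr_ge0 => i _; rewrite ltW// hl.1. Qed.

Lemma psum_addl k : start k + l k = \sum_(i < r | (f i <= f k)%N) l i.
Proof.
rewrite [RHS](bigD1 k)//= addrC; congr +%R; apply: eq_bigl => i.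
by rewrite ltn_neqAle andbC (inj_eq fI).
Qed.

Lemma le_psum (P Q : pred 'I_r) : subpred P Q ->
  \sum_(i < r | P i) l i <= \sum_(i < r | Q i) l i.
Proof.
move=> PQ; rewrite [leRHS](bigID P)/= [X in X + _](_ : _ = \sum_(i < r | P i) l i).
  by rewrite lerDl sumr_ge0// => i _; rewrite ltW// hl.1.
by apply: eq_bigl => i; rewrite andbC; case: (boolP (P i)) => //= /PQ.
Qed.

Lemma psum_lt {k k'} : (f k < f k')%N -> start k + l k <= start k'.
Proof.
by move=> kk'; rewrite psum_addl; apply: le_psum => i /leq_ltn_trans; exact.
Qed.

Lemma psum_le1 k : start k + l k <= 1.
Proof. by rewrite psum_addl -hl.2; exact: le_psum. Qed.

Lemma psum_inj {k k'} {x : R} : start k <= x < start k + l k ->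
  start k' <= x < start k' + l k' -> k = k'.
Proof.
move=> h h'; apply: fI; case: (ltngtP (f k) (f k')) => // /psum_lt kk; exfalso; lra.
Qed.

End PartialSums.

(** * Interval exchanges: pieces, measure invariance, displacements *)

Section IntervalExchange.
Context {R : realType} {r : nat} (pi : {perm 'I_r}) {l : 'I_r -> R}.
Context (hl : iet_data l).
Local Notation mu := (@lebesgue_measure R).
Local Notation T := (iet pi l).
Local Notation I01 := (`[0%R, 1%R[%classic : set R).

Let img k := \sum_(i < r | (pi i < pi k)%N) l i.

Let piI : injective (fun k => pi k : nat).
Proof. by move=> i j /ord_inj/perm_inj. Qed.

Let right_endE k : right_end l k = left_end l k + l k.
Proof. by rewrite (psum_addl (@ord_inj r)). Qed.

(** The intervals are disjoint by [psum_inj], so a single term of the sum defining [iet]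
    survives. *)
Lemma iet_piece {k x} : left_end l k <= x < left_end l k + l k ->
  T x = x + (img k - left_end l k).
Proof.
move=> xk; rewrite /iet; congr +%R; rewrite (bigD1 k)//= right_endE xk.
rewrite [X in _ + X]big1 ?addr0// => j jk; rewrite right_endE; case: ifP => // xj.
by move: jk; rewrite (psum_inj hl (@ord_inj r) xk xj) eqxx.
Qed.

Lemma iet_cover {x : R} : 0 <= x < 1 ->
  exists k, left_end l k <= x < left_end l k + l k.
Proof.
move=> /andP[x0 x1].
pose S m := \sum_(i < r | (i < m)%N) l i.
have : exists m, x < S m.
  by exists r; rewrite /S (eq_bigl xpredT) ?hl.2// => i; rewrite ltn_ord.
(* The least index with [x < S] is positive because [S 0 = 0]. Its predecessor [m] fails the
   inequality, so [x] lies in the piece that starts at [S m]. *)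
move/ex_minnP => [[|m] hm mmin].
  by move: hm; rewrite /S big_pred0 ?ltNge ?x0.
have mr : (m < r)%N.
  rewrite ltnNge; apply/negP => rm; have /mmin : x < S m; last by rewrite ltnn.
  rewrite /S (eq_bigl xpredT) ?hl.2// => i; exact: leq_trans (ltn_ord i) rm.
exists (Ordinal mr); rewrite -right_endE hm andbT leNgt; apply/negP => /mmin.
by rewrite ltnn.
Qed.

Lemma measurable_iet : measurable_fun setT T.
Proof.
apply: measurable_funD => //; apply: measurable_sum => k.
apply: measurable_fun_ifT => //.
apply: measurable_and => /=; first exact: measurable_fun_ler.
exact: measurable_fun_ltr.
Qed.

Lemma measurable_iter_iet n : measurable_fun setT (iter n T).
Proof.
elim: n => [|n ih] /=; first exact: measurable_id.
by apply: (measurableT_comp measurable_iet ih).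
Qed.

(** The part of the preimage in [I_k] is a translate of [J k], the part of [A] in the image of
    [I_k]. These images are disjoint and lie in [[0, 1)]. *)
Lemma measure_preimage_iet {A : set R} : measurable A ->
  (mu (I01 `&` T @^-1` A) <= mu (I01 `&` A))%E.
Proof.
move=> mA.
have mI B : measurable B -> measurable (I01 `&` B : set (measurableTypeR R)).
  by apply: measurableI; exact: measurable_itv.
have mT : measurable (I01 `&` T @^-1` A : set (measurableTypeR R)).
  by apply: mI; rewrite -[X in measurable X]setTI;
  exact: (measurable_iet measurableT _ mA).
pose J k := `[img k, img k + l k[%classic `&` A.
pose sh k (x : R) := x + (img k - left_end l k).
have mJ k : measurable (J k : set (measurableTypeR R)).
  by apply: measurableI => //; exact: measurable_itv.
have msh k : measurable (sh k @^-1` J k : set (measurableTypeR R)).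
  have mf : measurable_fun setT (sh k) by exact: measurable_funD.
  by rewrite -[X in measurable X]setTI; exact: (mf measurableT _ (mJ k)).
apply: (@le_trans _ _ (\sum_(k \in [set: 'I_r]) mu (sh k @^-1` J k))%E).
  apply: content_sub_fsum => //; first exact: finite_finset.
  move=> x [/=].
  rewrite in_itv/= => /iet_cover[k xk]; rewrite (iet_piece xk) => Ax.
  exists k => //; split => //=; rewrite in_itv/= /sh; lra.
under eq_fsbigr do rewrite lebesgue_measure_shift//.
rewrite -measure_fin_bigcup//; [|exact: finite_finset|].
  2: move=> i j _ _ [x [[/= xi _] [/= xj _]]]; exact: (psum_inj hl piI xi xj).
apply: le_measure; rewrite ?inE.
- by apply: fin_bigcup_measurable => //; exact: finite_finset.
- exact: mI.
move=> x [k _ [/= xk Ax]]; split=> //=; rewrite !in_itv/= in xk *.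
have := psum_ge0 (f := fun i => pi i) hl k; have := psum_le1 hl piI k.
rewrite -/(img k); lra.
Qed.

Lemma measure_preimage_iter_iet n {A : set R} : measurable A ->
  (mu (I01 `&` iter n T @^-1` A) <= mu (I01 `&` A))%E.
Proof.
elim: n A => [//|n ih] A mA.
have mTA : measurable (T @^-1` A : set (measurableTypeR R)).
  by rewrite -[X in measurable X]setTI; exact: (measurable_iet measurableT _ mA).
exact: le_trans (ih _ mTA) (measure_preimage_iet mA).
Qed.

(** Displacements add up along an orbit, so those of [T^(n+1)] are sums of one of [T] and one of
    [T^n]. *)
Lemma finite_displacement n : finite_set (range (fun x => iter n T x - x)).
Proof.
elim: n => [|n ih].
  apply: (sub_finite_set _ (finite_set1 0)) => _ [x _ <-] /=.
  by rewrite subrr.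
have h1 : finite_set (range (fun x => T x - x)).
  (* The truth values of the conditions that [x] lies in [I_k] determine [T x - x], also for [x]
     outside [[0, 1)]. *)
  pose D (b : {ffun 'I_r -> bool}) : R :=
    \sum_k (if b k then img k - left_end l k else 0).
  apply: (@sub_finite_set _ _ (range D)); last exact/finite_image/finite_finset.
  move=> _ [x _ <-].
  exists [ffun k => (left_end l k <= x) && (x < right_end l k)] => //.
  by rewrite /iet addrC addKr; apply: eq_bigr => k _; rewrite ffunE.
have h2 : finite_set (range (fun x => T (iter n T x) - iter n T x)).
  by apply: (sub_finite_set _ h1) => _ [x _ <-]; exists (iter n T x).
apply: (sub_finite_set _ (finite_image11 +%R h2 ih)) => _ [x _ <-] /=.
by exists x => //; rewrite addrA subrK.
Qed.

(** Finiteness makes [cardR] a genuine cardinality, since [fset_set] sends an infinite set to the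
    empty one. *)
Lemma finite_Delta'_n n : finite_set (Delta'_n T n).
Proof.
have fD k : finite_set (Delta (iter k T)).
  apply: (sub_finite_set _ (finite_image (@fracR R) (finite_displacement k))).
  by move=> _ [x _ <-]; exists (iter k T x - x) => //; exists x.
apply: bigcup_finite => [|k _]; last exact: finite_image2.
by apply: (sub_finite_set _ (finite_II n.+1)) => k /= /andP[].
Qed.

Lemma iter_iet_sub {n N x y} : (0 < n <= N)%N -> x \in `[0, 1[ -> y \in `[0, 1[ ->
  exists2 u, Delta'_n T N u & exists m : int,
    iter n T x - iter n T y = x + u - y + m%:~R.
Proof.
move=> nN xI yI.
exists (subm1 (subm1 (iter n T x) x) (subm1 (iter n T y) y)).
  exists n => //; exists (subm1 (iter n T x) x); first by exists x.
  by exists (subm1 (iter n T y) y) => //; exists y.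
(* The integer [m] collects the three floors dropped by the subtractions modulo 1. *)
rewrite /subm1 /fracR; set a := Num.floor _; set b := Num.floor _.
set c := Num.floor _; exists (a - b + c).
by rewrite rmorphD rmorphB/=; ring.
Qed.

(** * Pairs of points whose orbits come close at some time in [[N, 2N)] *)

Definition close_pairs N d : set (measurableTypeR R * measurableTypeR R) :=
  \bigcup_(i in `I_N) [set z | [/\ z.1 \in `[0, 1[, z.2 \in `[0, 1[ &
    distZ (iter (N + i) T z.1 - iter (N + i) T z.2) < d]].

Lemma measurable_close_pairs N d : measurable (close_pairs N d).
Proof.
apply: fin_bigcup_measurable => [|i _]; first exact: finite_II.
pose g (z : measurableTypeR R * measurableTypeR R) : measurableTypeR R :=
  iter (N + i) T z.1 - iter (N + i) T z.2.
have mg : measurable_fun setT g.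
  apply: measurable_funB; apply: measurableT_comp => //;
    exact: measurable_iter_iet.
rewrite (_ : [set _ | _] = (I01 `*` I01) `&` g @^-1` [set t | distZ t < d]).
  apply: measurableI; first by apply: measurableX; exact: measurable_itv.
  by rewrite -[X in measurable X]setTI; exact: (mg measurableT _ (measurable_distZ_lt d)).
by apply/seteqP; split=> z /=; [case|case=> -[]].
Qed.


Let mu_I01 : mu I01 = 1%E.
Proof. by rewrite lebesgue_measure_itv/= lte_fin ltr01 oppr0 adde0. Qed.

Lemma measure_close_pairs_le N d M : 0 <= M ->
  (forall x, x \in `[0, 1[ -> (mu (xsection (close_pairs N d) x) <= M%:E)%E) ->
  ((mu \x mu) (close_pairs N d) <= M%:E)%E.
Proof.
move=> M0 hM; rewrite -[leRHS]mule1.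
rewrite -mu_I01; apply: product_measure1_le => //.
- exact: measurable_close_pairs.
- by move=> z [i _ /= []].
Qed.

(** For fixed [x] and time [n], the admissible [y] form the preimage under [T^n] of a window around
    [T^n x]; invariance bounds its measure by [6 * d], and there are [N] times. *)
Lemma measure_close_pairs_le_iter {N d} : 0 <= d ->
  ((mu \x mu) (close_pairs N d) <= (6 * d *+ N)%:E)%E.
Proof.
move=> d0; apply: measure_close_pairs_le => [|x xI].
  by rewrite mulrn_wge0// mulr_ge0.
rewrite -[in leRHS](card_fset_set (card_eqxx `I_N)).
pose W i : set (measurableTypeR R) :=
  [set y | distZ (iter (N + i) T x - y) < d].
have mW i : measurable (W i).
  have mf : measurable_fun setT (fun y : R => iter (N + i) T x - y).
    exact: measurable_funB.
  by rewrite -[X in measurable X]setTI; exact: (mf measurableT _ (measurable_distZ_lt d)).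
apply: (measure_finite_cover (mu := mu) `I_N (fun i => I01 `&` iter (N + i) T @^-1` W i)).
- exact: finite_II.
- by apply: measurable_xsection; exact: measurable_close_pairs.
- move=> i _; split.
    apply: measurableI; first exact: measurable_itv.
    by rewrite -[X in measurable X]setTI;
    exact: (measurable_iter_iet (N + i) measurableT _ (mW i)).
  apply: le_trans (measure_preimage_iter_iet _ (mW i)) _.
  exact: lebesgue_measure_window.
move=> y; rewrite /xsection/= inE => -[i iN [/= _ yI xy]].
by exists i.
Qed.

(** For fixed [x], all times with the same [u] share one window around [x + u], so displacements are
    counted instead of times. *)
Lemma measure_close_pairs_le_card {N d} : (0 < N)%N -> 0 <= d ->
  ((mu \x mu) (close_pairs N d) <=
    (6 * d *+ cardR (Delta'_n T (N + N)))%:E)%E.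
Proof.
move=> N0 d0; apply: measure_close_pairs_le => [|x xI].
  by rewrite mulrn_wge0// mulr_ge0.
apply: (measure_finite_cover (mu := mu) (Delta'_n T (N + N))
  (fun u : R => [set y | (y \in `[0, 1[) /\ distZ (x + u - y) < d])).
- exact: finite_Delta'_n.
- by apply: measurable_xsection; exact: measurable_close_pairs.
- move=> u _; split; last exact: lebesgue_measure_window.
  by apply: measurable_window; exact: measurable_funB.
move=> y; rewrite /xsection/= inE => -[i /= iN [/= _ yI xy]].
(* Positivity of [N] matters here: [Delta'_n] starts at the first iterate. *)
have nN : (0 < N + i <= N + N)%N by lia.
have [u Du [m E]] := iter_iet_sub nN xI yI.
by exists u => //=; split => //; rewrite E distZDz in xy.
Qed.

Lemma Cpsi_set_excluded (a c q : R) (J : nat) : 0 <= c -> 0 < q < 1 ->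
  (forall j, (J <= j)%N ->
    ((mu \x mu) (close_pairs (2 ^ j) ((2 ^ j)%:R `^ (- a))%R) <= (c * q ^+ j)%:E)%E) ->
  ~ Cpsi_set T a.
Proof.
move=> c0 q01 hc [a0 [Z [mZ Z0 hZ]]].
(* Starting at [J] makes the assumed bound available for every index of [F]. *)
pose F j := close_pairs (2 ^ (J + j)) ((2 ^ (J + j))%:R `^ (- a)).
have mF j : measurable (F j) by exact: measurable_close_pairs.
have F0 : (mu \x mu)%E (lim_sup_set F) = 0%E.
  apply: lim_sup_set_cvg0 => //.
  apply: (nneseries_geometric_lty _ (c * q ^+ J) q) => //.
    by rewrite mulr_ge0// exprn_ge0// ltW//; case/andP: q01.
  by move=> n; rewrite measure_ge0/= -mulrA -exprD hc// leq_addr.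
have mL : measurable (lim_sup_set F).
  by apply: bigcap_measurable => // k _; apply: bigcup_measurable => j _.
(* Off [Z] the lower limit is 0, whereas off the limsup set it is at least 1. Hence the unit square,
   of measure 1, would lie in a null set. *)
have sq : I01 `*` I01 `<=` Z `|` lim_sup_set F.
  move=> z [/= z1 z2]; apply: contrapT => /not_orP[nZ nL].
  have {nZ} : limn_einf (fun n =>
      ((n%:R `^ a) * distZ (iter n T z.1 - iter n T z.2))%:E) = 0%E.
    by apply: contrapT => h; apply: nZ; apply: hZ => /= /(_ z1 z2).
  apply/eqP; rewrite gt_eqF// (@lt_le_trans _ _ 1%E)// limn_einf_ge//.
  have [K hK] : exists K, forall j, (K <= j)%N -> ~ F j z.
    apply: contrapT => h; apply: nL => K _; apply: contrapT => nK.
    by apply: h; exists K => j Kj Fj; apply: nK; exists j.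
  exists (2 ^ (J + K))%N => // n /= Jn.
  have n0 : (0 < n)%N by apply: leq_trans Jn; rewrite expn_gt0.
  have /andP[jn nj] := @trunc_log_bounds 2 n isT n0.
  (* The dyadic block of [n] is [[2^j, 2^(j+1))], which is entry [j - J] of [F]. *)
  set j := trunc_log 2 n in jn nj.
  have JKj : (J + K <= j)%N by rewrite trunc_log_max.
  have /hK nF : (K <= j - J)%N by lia.
  have {}nF : (2 ^ j)%:R `^ (- a) <= distZ (iter n T z.1 - iter n T z.2).
    rewrite leNgt; apply/negP => h; apply: nF.
    rewrite /F subnKC; last by lia.
    exists (n - 2 ^ j)%N => /=; first by rewrite expnS in nj; lia.
    by rewrite subnKC.
  (* It remains to see that [n^a] times [(2^j)^(-a)] is at least 1, which follows from [2^j <= n]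
     and [a > 0]. *)
  rewrite lee_fin; apply: le_trans (ler_wpM2l (powR_ge0 _ _) nF).
  rewrite powRN -[leLHS](@divff _ ((2 ^ j)%:R `^ a)); last first.
    by rewrite gt_eqF// powR_gt0// ltr0n expn_gt0.
  rewrite ler_wpM2r ?invr_ge0 ?powR_ge0// ge0_ler_powR ?nnegrE ?ler_nat//.
  exact: ltW.
have : ((mu \x mu) (I01 `*` I01) <= (mu \x mu) (Z `|` lim_sup_set F))%E.
  apply: le_measure; rewrite ?inE//; last exact: measurableU.
  by apply: measurableX; exact: measurable_itv.
have -> : (mu \x mu)%E (Z `|` lim_sup_set F) = 0%E.
  exact: etrans (measureU0 mZ mL F0) Z0.
have -> : (mu \x mu)%E (I01 `*` I01) = 1%E.
  transitivity (mu I01 * mu I01)%E; last by rewrite mu_I01 mule1.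
  by apply: product_measure1E; exact: measurable_itv.
by rewrite lee_fin ler10.
Qed.

(** * The two bounds on the exponent *)

Let powR2X (s : R) j : (2 ^ j)%:R `^ s = (2 `^ s) ^+ j.
Proof.
by rewrite natrX -powR_mulrn// -powRrM mulrC powRrM powR_mulrn// powR_ge0.
Qed.

Let powR2_itv (s : R) : s < 0 -> 0 < 2 `^ s < 1.
Proof.
move=> s0; rewrite powR_gt0//= -[ltRHS](powRr0 2) /powR pnatr_eq0/=.
by rewrite ltr_expR ltr_pM2r// ln_gt0// ltr1n.
Qed.

(** With [2^j] times and distance [2^(-ja)], the bound by times is [6 * 2^(j(1-a))], geometric of
    ratio below 1 when [a > 1]. *)
Lemma Cpsi_set_le1 {a} : Cpsi_set T a -> a <= 1.
Proof.
move=> aT; rewrite leNgt; apply/negP => a1; move: aT.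
apply: (@Cpsi_set_excluded _ 6 (2 `^ (1 - a)) 0) => //.
  by apply: powR2_itv; rewrite subr_lt0.
move=> j _; apply: le_trans (measure_close_pairs_le_iter (powR_ge0 _ _)) _.
rewrite lee_fin -mulrnAr ler_wpM2l// -mulr_natr.
rewrite -[X in _ * X](powRr1 (ler0n _ _)) -powRD.
  by rewrite powR2X addrC.
by rewrite pnatr_eq0 expn_eq0 implybT.
Qed.

Lemma tau_entropy_ge0 : (0 <= tau_entropy T)%E.
Proof.
apply: limf_esup_ge0 => [|n]; first exact: filter_not_empty.
(* The convention [ln 0 = 0] covers an empty set and [n = 0]. *)
rewrite lee_fin; have ln_nat k : 0 <= ln (k%:R : R).
  by case: k => [|k]; [rewrite ln0|rewrite ln_ge0// ler1n].
by rewrite divr_ge0.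
Qed.

Lemma Cpsi_set_le_tau {a} : Cpsi_set T a -> (a%:E <= tau_entropy T)%E.
Proof.
move=> aT; rewrite leNgt; apply/negP => ta.
have tau0 := tau_entropy_ge0.
(* Here [ta] excludes an infinite entropy and [tau0] excludes minus infinity, so a midpoint serves
   as [b]. *)
have [b taub ba] : exists2 b : R, (tau_entropy T < b%:E)%E & b < a.
  move: ta tau0; case: (tau_entropy T) => [t| |]//; rewrite lte_fin => ta _.
  by exists ((t + a) / 2); rewrite ?lte_fin; lra.
have [M _ hM] := limn_esup_lt taub.
(* The displacement count at [2^(j+1)] is at most [2^((j+1)b)]; the extra [2^b] goes into the
   constant, leaving the ratio [2^(b-a)]. *)
move: aT; apply: (@Cpsi_set_excluded _ (6 * 2 `^ b) (2 `^ (b - a)) M).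
- by rewrite mulr_ge0// powR_ge0.
- by apply: powR2_itv; rewrite subr_lt0.
move=> j Mj; apply: le_trans (measure_close_pairs_le_card _ (powR_ge0 _ _)) _.
  by rewrite expn_gt0.
rewrite lee_fin addnn -mul2n -expnS; set k := cardR _.
have kb : k%:R <= (2 ^ j.+1)%:R `^ b.
  (* Zero is treated apart because exponentiating [ln k] recovers [k] only for positive [k]. *)
  have [->|k0] := posnP k; first exact: powR_ge0.
  have : ln k%:R / ln (2 ^ j.+1)%:R < b.
    rewrite -lte_fin; apply: hM => /=.
    by apply: leq_trans Mj _; rewrite ltnW// ltnW// ltn_expl.
  rewrite ltr_pdivrMr; last by rewrite ln_gt0// ltr1n -(expn0 2) ltn_exp2l.
  rewrite -ltr_expR lnK ?posrE ?ltr0n// => /ltW/le_trans; apply.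
  by rewrite /powR pnatr_eq0 expn_eq0.
rewrite -mulr_natr -!mulrA ler_wpM2l//.
apply: le_trans (ler_wpM2l (powR_ge0 _ _) kb) _.
rewrite !powR2X exprS [leRHS](_ : _ = (2 `^ (- a)) ^+ j * (2 `^ b * 2 `^ b ^+ j))//.
rewrite addrC powRD ?pnatr_eq0 ?implybT// exprMn; ring.
Qed.

End IntervalExchange.

Local Open Scope ereal_scope.

Theorem theorem11p3 (R : realType) (r : nat) (pi : {perm 'I_r}) (l : 'I_r -> R) :
  iet_data l ->
  Cpsi (iet pi l) <= mine 1 (tau_entropy (iet pi l)) /\
  (tau_entropy (iet pi l) = 0 -> Cpsi (iet pi l) = 0).
Proof.
move=> hl.
have Cle : Cpsi (iet pi l) <= mine 1 (tau_entropy (iet pi l)).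
  (* The supremum also runs over the adjoined 0, for which nonnegativity of the entropy is used. *)
  apply: ge_ereal_sup => _ [->|[a aT <-]]; rewrite le_min.
    by rewrite lee01/=; exact: tau_entropy_ge0.
  by rewrite lee_fin (Cpsi_set_le1 pi hl aT) (Cpsi_set_le_tau pi aT).
split=> // tau0; apply/eqP; rewrite eq_le; apply/andP; split.
  by rewrite (le_trans Cle)// tau0 ge_min lexx orbT.
by apply: ereal_sup_ubound; left.
Qed.
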